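(* Let $\alpha\in(0,1]$ and let $\mu$ be a finite Borel measure on $\mathbb{R}^d$ such that $\widehat\mu$ is $\alpha$-Hölder. Then, for all $\theta\in[0,1]$, \[ \dim_{\mathrm F}^{\theta}\mu\leq \dim_{\mathrm F}\mu+d\left(1+\frac{\dim_{\mathrm F}\mu}{2\alpha}\right)\theta . \] In particular, $\theta\mapsto\dim_{\mathrm F}^{\theta}\mu$ is Lipschitz continuous at $\theta=0$ and therefore Lipschitz continuous on $[0,1]$.
   Context: For a finite Borel measure $\mu$ on $\mathbb{R}^d$ write $\widehat\mu(z)=\int e^{-2\pi i z\cdot x}\,d\mu(x)$. For $s\geq 0$ and $\theta\in(0,1]$ let $\mathcal{J}_{s,\theta}(\mu)=\left(\int_{\mathbb{R}^d}|\widehat\mu(z)|^{2/\theta}|z|^{s/\theta-d}\,dz\right)^{\theta}$, and let $\mathcal{J}_{s,0}(\mu)=\sup_{z\in\mathbb{R}^d}|\widehat\mu(z)|^2|z|^s$. The Fourier spectrum of $\mu$ at $\theta\in[0,1]$ is $\dim_{\mathrm F}^{\theta}\mu=\sup\{s\geq 0:\mathcal{J}_{s,\theta}(\mu)<\infty\}\in[0,\infty]$, with $\sup\emptyset=0$, and $\dim_{\mathrm F}\mu=\dim_{\mathrm F}^{0}\mu$ is the Fourier dimension. A function $g$ on $\mathbb{R}^d$ is $\alpha$-Hölder if there is $C>0$ with $|g(x)-g(y)|\leq C|x-y|^\alpha$ for all $x,y$. If $\dim_{\mathrm F}\mu=\infty$, the Fourier spectrum is identically $\infty$ and the Lipschitz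 assertion is regarded as trivially true. *)

(* Defs.v *)
From HB Require Import structures.
From mathcomp Require Import all_boot all_order all_algebra.
From mathcomp Require Import complex.
From mathcomp Require Import all_classical all_reals all_analysis.

Set Implicit Arguments.
Unset Strict Implicit.
Unset Printing Implicit Defensive.
Import Order.TTheory GRing.Theory Num.Theory numFieldNormedType.Exports.

Local Open Scope classical_set_scope.
Local Open Scope ring_scope.

(* R^d with its Borel sigma-algebra: the topology of 'rV[R]_d is the usual
   (product) one. *)
Notation borelRn R d := (g_sigma_algebraType (@open 'rV[R]_d)).

Section coordinates.
Context {R : realType}.

Lemma measurable_coord d (i : 'I_d) :
  measurable_fun [set: borelRn R d] (fun v : 'rV[R]_d => v ord0 i).
Proof.
apply: (measurability _ (measurable_realfun.RGenOpens.measurableE R)) => _ [_ [a [b ->] <-]].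
rewrite setTI; apply: sub_sigma_algebra.
apply: open_comp; last exact: interval_open.
by move=> v _; exact: coord_continuous.
Qed.

Lemma measurable_coordP d dT (T : measurableType dT) (f : T -> 'rV[R]_d) :
  (forall i, measurable_fun setT (fun t => f t ord0 i)) ->
  measurable_fun setT (f : T -> borelRn R d).
Proof.
move=> mf.
apply: (@measurability _ _ _ (borelRn R d) setT f open) => // _ [U oU <-].
rewrite setTI.
pose box (q : 'rV[rat]_d * 'rV[rat]_d) : set 'rV[R]_d :=
  [set v | forall i, v ord0 i \in `]ratr (q.1 ord0 i), ratr (q.2 ord0 i)[%R].
pose D := [set q | box q `<=` U].
have -> : f @^-1` U = \bigcup_(q in D) (f @^-1` box q).
  apply/seteqP; split => [t Uft|t [q qD]]; last exact: qD.
  have : nbhs (f t) U by apply: open_nbhs_nbhs.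
  case=> P Pf PU.
  have /choice[q qP] : forall i : 'I_d, exists q : rat * rat,
      f t ord0 i \in `]ratr q.1, ratr q.2[%R /\
      [set` `]ratr q.1, ratr q.2[%R] `<=` P ord0 i.
    move=> i; have /nbhs_ballP[e /= e0 eP] := Pf ord0 i.
    have /rat_in_itvoo[a] : f t ord0 i - e < f t ord0 i by rewrite ltrBlDr ltrDl.
    have /rat_in_itvoo[b] : f t ord0 i < f t ord0 i + e by rewrite ltrDl.
    rewrite !in_itv/= => /andP[fb be] /andP[ea af].
    exists (a, b); split; first by rewrite in_itv/= af fb.
    move=> x/=; rewrite in_itv/= => /andP[ax xb]; apply: eP.
    by rewrite /ball/= distrC ltr_distl (lt_trans ea)//= (lt_trans xb).
  exists (\row_i (q i).1, \row_i (q i).2) => [v vq|i]/=; last first.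
    by rewrite !mxE; have [] := qP i.
  apply: PU => i j; rewrite (ord1 i).
  by have [_] := qP j; apply; have := vq j; rewrite /= !mxE.
rewrite bigcup_mkcond; apply: countable_bigcupT_measurable => // q.
case: ifPn => // _.
rewrite (_ : f @^-1` _ = \bigcap_i (fun t => f t ord0 i) @^-1`
    [set` `]ratr (q.1 ord0 i), ratr (q.2 ord0 i)[%R]); last first.
  by apply/seteqP; split => [t h i _|t h i]; exact: h.
apply: fin_bigcap_measurable => // i _; rewrite -[_ @^-1` _]setTI.
exact: mf.
Qed.

Definition vcons d (p : R * 'rV[R]_d) : 'rV[R]_d.+1 :=
  \row_(i < d.+1) oapp (p.2 ord0) p.1 (unlift ord0 i).

Definition vuncons d (v : 'rV[R]_d.+1) : R * 'rV[R]_d :=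
  (v ord0 ord0, \row_(i < d) v ord0 (lift ord0 i)).

Lemma vconsK d : cancel (@vcons d) (@vuncons d).
Proof.
move=> [x v]; rewrite /vuncons !mxE unlift_none/=; congr pair.
by apply/rowP => i; rewrite !mxE liftK.
Qed.

Lemma measurable_vcons d :
  measurable_fun setT (@vcons d : R * borelRn R d -> borelRn R d.+1).
Proof.
apply: measurable_coordP => i.
under eq_fun do rewrite mxE.
case: unliftP => [j _|_]/=; last exact: measurable_fst.
exact: measurableT_comp (measurable_coord j) measurable_snd.
Qed.

Lemma measurable_vuncons d :
  measurable_fun setT (@vuncons d : borelRn R d.+1 -> R * borelRn R d).
Proof.
apply/measurable_fun_pair; first exact: measurable_coord.
apply: measurable_coordP => i.
by under eq_fun do rewrite mxE; exact: measurable_coord.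
Qed.

End coordinates.

Section lebesgue_step.
Context {R : realType} {d : nat}.
Variable m : {sigma_finite_measure set (borelRn R d) -> \bar R}.

Definition lebesgue_step : set (borelRn R d.+1) -> \bar R :=
  pushforward (lebesgue_measure \x m)%E
    (@vcons R d : R * borelRn R d -> borelRn R d.+1).

HB.instance Definition _ := Measure.copy lebesgue_step
  (measure_function_pushforward__canonical__measure_function_Measure
     (lebesgue_measure \x m)%E (@measurable_vcons R d)).

Let lebesgue_step_sigma_finite : sigma_finite setT lebesgue_step.
Proof.
have /sigma_finiteP[F [TF ndF Foo]] := sigma_finiteT (@lebesgue_measure R).
have /sigma_finiteP[G [TG ndG Goo]] := sigma_finiteT m.
exists (fun n => @vuncons R d @^-1` (F n `*` G n)).
  apply/esym/seteqP; split => // v _.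
  have [n _ Fn] : (\bigcup_n F n) (vuncons v).1 by rewrite -TF.
  have [k _ Gk] : (\bigcup_n G n) (vuncons v).2 by rewrite -TG.
  exists (maxn n k) => //; split.
    exact: (subsetPset _ _ (ndF _ _ (leq_maxl n k))).
  exact: (subsetPset _ _ (ndG _ _ (leq_maxr n k))).
move=> n; have [mF Fn] := Foo n; have [mG Gn] := Goo n; split.
  by rewrite -[_ @^-1` _]setTI; apply: measurable_vuncons => //;
    exact: measurableX.
rewrite /lebesgue_step /pushforward -comp_preimage.
rewrite (_ : _ \o _ = id); last by apply/funext => p; exact: vconsK.
by rewrite preimage_id product_measure1E// lte_mul_pinfty// ge0_fin_numE.
Qed.

HB.instance Definition _ := Measure_isSigmaFinite.Build _ _ _ lebesgue_step
  lebesgue_step_sigma_finite.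

End lebesgue_step.

(* Lebesgue measure on R^d: the unit point mass for d = 0, and (the image under
   R * R^d -> R^d.+1 of) the product of Lebesgue measures otherwise. *)
Fixpoint lebesgueRn (R : realType) (d : nat) :
    {sigma_finite_measure set (borelRn R d) -> \bar R} :=
  if d is d'.+1 then @lebesgue_step R d' (lebesgueRn R d')
  else @dirac _ (borelRn R 0) (0 : 'rV[R]_0) R.

Section fourier_spectrum.
Context {R : realType} {d : nat}.
Implicit Types (x y z : 'rV[R]_d) (g : 'rV[R]_d -> R[i]).

Definition dotp x y : R := \sum_(i < d) x ord0 i * y ord0 i.

(* The library norm on 'rV[R]_d is the sup norm. *)
Definition enorm x : R := Num.sqrt (dotp x x).

(* e^(i t) *)
Definition expi (t : R) : R[i] := (cos t +i* sin t)%C.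

Definition cintegral (mu : {measure set (borelRn R d) -> \bar R}) g : R[i] :=
  ((\int[mu]_(x in setT) complex.Re (g x))
     +i* (\int[mu]_(x in setT) complex.Im (g x)))%C.

Definition hoelder_continuous (alpha : R) g :=
  exists2 C : R, 0 < C &
    forall x y, Normc.normc (g x - g y) <= C * enorm (x - y) `^ alpha.

Variable mu : {finite_measure set (borelRn R d) -> \bar R}.

Definition fourier z : R[i] :=
  cintegral mu (fun x => expi (- (2 * pi * dotp z x))).

Local Open Scope ereal_scope.

(* `^ takes the value 1 at (0, 0) and 0 at (0, p) for p != 0; for theta != 0 the
   value of the integrand at z = 0 only matters when d = 0. *)
Definition energy (s theta : R) : \bar R :=
  if theta == 0%R then
    ereal_sup [set (Normc.normc (fourier z) ^+ 2 * enorm z `^ s)%R%:E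
              | z in [set: 'rV[R]_d]]
  else (\int[lebesgueRn R d]_z
          (Normc.normc (fourier z) `^ (2 / theta)
             * enorm z `^ (s / theta - d%:R))%R%:E) `^ theta.

(* maxe 0 implements sup set0 = 0. *)
Definition fourier_spectrum (theta : R) : \bar R :=
  maxe 0 (ereal_sup [set s%:E | s in [set s : R | (0 <= s)%R /\
                                                 energy s theta < +oo]]).

Definition fourier_dim : \bar R := fourier_spectrum 0.

End fourier_spectrum.

(* Main.v *)
Require Import Defs.
From mathcomp Require Import all_boot all_order all_algebra complex.
From mathcomp Require Import all_classical all_reals all_analysis measurable_realfun.
From mathcomp Require Import ring lra.
Import Order.TTheory GRing.Theory Num.Theory numFieldNormedType.Exports.
Local Open Scope classical_set_scope.
Local Open Scope ring_scope.

(* Write phi = |fourier mu|.  If phi is Hoelder of exponent alpha, then phi stays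
   above phi z / 2 on a ball around z of radius comparable to
   phi z `^ (1 / alpha); integrating over that ball turns finiteness of
   J_(s,theta) into the pointwise bound
   phi z `^ (2 / theta + d / alpha) * |z| `^ (s / theta - d) <= B, that is, into
   J_(t,0) < oo with t = (s - d theta) / (1 + d theta / (2 alpha)).  This gives the
   linear upper bound, hence the Lipschitz bound at 0.  For the rest of [0, 1] the
   spectrum is nondecreasing, and interpolating the sup bound of J_(s0,0) with
   J_(s1,y) gives the concavity inequality between 0 and y at every x in ]0, y[,
   so that the slope of a chord from x to y is at most the slope of the chord from
   0 to x. *)

(** * Euclidean and sup norms on R^d, measurability, volume of balls *)

Section euclidean_space.
Context {R : realType}.

Lemma enorm_ge0 d (z : 'rV[R]_d) : 0 <= enorm z.
Proof. exact: sqrtr_ge0. Qed.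

Lemma dotp_ge0 d (z : 'rV[R]_d) : 0 <= dotp z z.
Proof. by apply: sumr_ge0 => i _; rewrite -expr2 sqr_ge0. Qed.

Lemma ler_norm_coord d (z : 'rV[R]_d) i : `|z ord0 i| <= `|z|.
Proof.
rewrite [leRHS]mx_normrE.
exact: (le_bigmax _ (fun ij : 'I_1 * 'I_d => `|z ij.1 ij.2|) (ord0, i)).
Qed.

Lemma ler_norm_enorm d (z : 'rV[R]_d) : `|z| <= enorm z.
Proof.
rewrite [leLHS]mx_normrE; apply/bigmax_leP; split; first exact: enorm_ge0.
move=> [i j] _ /=; rewrite (ord1 i) -sqrtr_sqr ler_wsqrtr// /dotp.
rewrite (bigD1 j)//= expr2 lerDl sumr_ge0// => k _.
by rewrite -expr2 sqr_ge0.
Qed.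

(** The constant d + 1 is cruder than the square root of d, but it stays positive for d = 0, so
    radii can be divided by it. *)
Lemma enorm_le_norm d (z : 'rV[R]_d) : enorm z <= d.+1%:R * `|z|.
Proof.
rewrite -[leRHS]ger0_norm ?mulr_ge0// -sqrtr_sqr ler_wsqrtr//.
have -> : (d.+1%:R * `|z|) ^+ 2 = (d.+1%:R ^+ 2) * `|z| ^+ 2 by rewrite exprMn.
apply: (@le_trans _ _ (\sum_(i < d) `|z| ^+ 2)).
  apply: ler_sum => i _; rewrite -expr2 -[leLHS]real_normK ?num_real//.
  by rewrite ler_sqr ?nnegrE ?ler_norm_coord.
rewrite sumr_const card_ord -[leLHS]mulr_natl ler_wpM2r ?sqr_ge0//.
by rewrite -natrX ler_nat -mulnn (leq_trans (leqnSn d))// leq_pmulr.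
Qed.

Lemma norm_eq0_enorm d (z : 'rV[R]_d) : (enorm z == 0) = (z == 0).
Proof.
apply/eqP/eqP => [z0|->].
  apply/eqP; rewrite -normr_le0.
  by rewrite (le_trans (ler_norm_enorm _ _))// z0.
by apply/eqP; rewrite eq_le enorm_ge0 andbT (le_trans (enorm_le_norm _ _))// normr0 mulr0.
Qed.

Lemma open_measurable_Rn d (U : set 'rV[R]_d) : open U ->
  measurable (U : set (borelRn R d)).
Proof. exact: sub_sigma_algebra. Qed.

Lemma measurable_continuous_Rn d (f : 'rV[R]_d -> R) : continuous f ->
  measurable_fun [set: borelRn R d] f.
Proof.
move=> cf.
apply: (measurability _ (RGenOpens.measurableE R)) => _ [_ [a [b ->] <-]].
rewrite setTI; apply: open_measurable_Rn.
by apply: open_comp; last exact: interval_open.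
Qed.

Lemma measurable_dotp d (z : 'rV[R]_d) :
  measurable_fun [set: borelRn R d] (dotp z).
Proof.
apply: measurable_sum => i; apply: measurable_funM => //.
exact: measurable_coord.
Qed.

Lemma measurable_enorm d : measurable_fun [set: borelRn R d] (@enorm R d).
Proof.
have -> : @enorm R d = fun z => dotp z z `^ 2^-1.
  by apply/funext => z; rewrite powR12_sqrt ?dotp_ge0.
apply: (measurableT_comp (measurable_powR _)).
by apply: measurable_sum => i; apply: measurable_funM; exact: measurable_coord.
Qed.

Lemma measurable_norm_Rn d :
  measurable_fun [set: borelRn R d] (fun z : 'rV[R]_d => `|z|).
Proof. by apply: measurable_continuous_Rn => z; exact: norm_continuous. Qed.

(** Balls are taken in the sup norm, so they are cubes: [vcons] pulls one back to an interval times
    a cube of one dimension less. *)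
Lemma lebesgueRn_ball d (z : 'rV[R]_d) r : 0 < r ->
  lebesgueRn R d (ball z r) = ((2 * r) ^+ d)%:E.
Proof.
move=> r0; elim: d z => [|d IH] z.
  rewrite /= diracE expr0 mem_set//.
  rewrite (_ : z = 0); first exact: ballxx.
  by apply/rowP => -[].
rewrite /= /lebesgue_step /pushforward.
rewrite (_ : _ @^-1` _ = ball (z ord0 ord0) r `*` ball (vuncons z).2 r); last first.
  apply/seteqP; split => [[x v]|[x v]] /=; rewrite /ball/=.
    move=> [_ h]; split.
      by have := h ord0 ord0; rewrite /vcons mxE unlift_none.
    split=> // i j; have := h ord0 (lift ord0 j).
    by rewrite /vcons !mxE liftK/= (ord1 i).
  move=> [h1 [_ h2]]; split=> // i j; rewrite (ord1 i) /vcons mxE.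
  case: unliftP => [k ->|->]//=.
  by have := h2 ord0 k; rewrite mxE.
rewrite product_measure1E; first last.
- by apply: open_measurable_Rn; exact: ball_open.
- exact: measurable_ball.
rewrite [X in (X * _)%E](_ : _ = (2 * r)%:E); last first.
  by rewrite mulr_natl -(lebesgue_measure_ball (z ord0 ord0) (ltW r0)).
by rewrite [X in (_ * X)%E]IH -EFinM exprS.
Qed.
End euclidean_space.

(** * Inequalities between powers, and integrability of powers of the norm *)

Section power_integrals.
Context {R : realType}.

(** A negative q reverses the order, so the second comparison is used in place of the first; the
    exponent |q| covers both signs. *)
Lemma powR_comparable (a b K q : R) : 0 < a -> 0 < b -> 1 <= K ->
  b <= K * a -> a <= K * b -> b `^ q <= K `^ `|q| * a `^ q.
Proof.
move=> a0 b0 K1 ba ab; have K0 : 0 <= K by rewrite (le_trans _ K1).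
have [q0|q0] := leP 0 q.
  rewrite ger0_norm// -powRM ?(ltW a0)//.
  by rewrite ge0_ler_powR ?nnegrE ?mulr_ge0 ?(ltW a0) ?(ltW b0).
rewrite ltr0_norm// -[q in leLHS]opprK -[X in a `^ X]opprK (powRN b) (powRN a).
rewrite ler_pdivlMr ?powR_gt0// mulrC ler_pdivrMr ?powR_gt0//.
by rewrite -powRM ?(ltW b0)// ge0_ler_powR ?nnegrE ?mulr_ge0 ?oppr_ge0 ?(ltW a0) ?(ltW b0) ?(ltW q0).
Qed.

(** A weak form of Young's inequality: a and b are both at most a + b, and the exponents add up to
    1. *)
Lemma powR_prod_le_sum (a b u v : R) : 0 <= a -> 0 <= b -> 0 <= u -> 0 <= v ->
  u + v = 1 -> a `^ u * b `^ v <= a + b.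
Proof.
move=> a0 b0 u0 v0 uv.
have ab0 : 0 <= a + b by rewrite addr_ge0.
have -> : a + b = (a + b) `^ u * (a + b) `^ v.
  have [<-|ab] := eqVneq 0 (a + b).
    by rewrite -powRD ?uv ?powRr1 ?oner_eq0.
  by rewrite -powRD ?uv ?powRr1 ?oner_eq0.
by rewrite ler_pM ?powR_ge0// ge0_ler_powR ?nnegrE// ?lerDl ?lerDr.
Qed.

Lemma nneseries_geometric_lty (a z : R) : 0 <= a -> 0 < z -> z < 1 ->
  (\sum_(0 <= k <oo) (a * z ^+ k)%:E < +oo)%E.
Proof.
move=> a0 z0 z1; apply: (@le_lt_trans _ _ (a / (1 - z))%:E); last exact: ltry.
apply: lime_le.
  by apply: is_cvg_nneseries => n _ _; rewrite lee_fin mulr_ge0// exprn_ge0// ltW.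
apply: nearW => n; rewrite sumEFin lee_fin.
by apply: (geometric_le_lim n) => //; rewrite gtr0_norm.
Qed.

(** The exponent k is the binary logarithm of the integer part of r. *)
Lemma dyadic_scale (r : R) : 1 <= r ->
  exists k, 2 ^+ k <= r /\ r <= 2 * 2 ^+ k.
Proof.
move=> r1; have r0 : 0 <= r by rewrite (le_trans _ r1).
have /andP[n1 n2] := truncn_itv r0.
have n0 : (0 < Num.truncn r)%N.
  by rewrite -ltnS -(@ltr_nat R) (le_lt_trans r1).
have /andP[k1 k2] := @trunc_log_bounds 2 _ isT n0.
exists (trunc_log 2 (Num.truncn r)); split.
  by rewrite (le_trans _ n1)// -natrX ler_nat.
by rewrite -exprS (le_trans (ltW n2))// -natrX ler_nat.
Qed.

Context {d : nat}.
Local Notation leb := (lebesgueRn R d).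

Lemma measurable_enorm_powR (p : R) (D : set (borelRn R d)) :
  measurable_fun D (fun z : borelRn R d => (enorm z `^ p)%:E).
Proof.
apply/measurable_EFinP; apply: measurable_funTS.
exact: (measurableT_comp (measurable_powR p) (@measurable_enorm R d)).
Qed.

(* For b = 2 the hypothesis reads p < - d and the shells b^k fill the exterior
   of the unit ball; for b = 1/2 it reads p > - d and they fill the interior. *)
Lemma integral_enorm_powR_shells (b p : R) (D : set (borelRn R d)) :
  0 < b -> b `^ (p + d%:R) < 1 -> measurable D ->
  (forall z : 'rV[R]_d, D z -> z != 0 ->
     exists k, b ^+ k <= 2 * `|z| /\ `|z| <= 2 * b ^+ k) ->
  (\int[leb]_(z in D) (enorm z `^ p)%:E < +oo)%E.
Proof.
move=> b0 bp mD Dk.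
pose K : R := 2 * d.+1%:R.
have K1 : 1 <= K by rewrite /K -natrM ler1n.
have K0 : 0 < K by rewrite (lt_le_trans _ K1).
pose c := K `^ `|p|.
have c0 : 0 <= c by rewrite powR_ge0.
pose B (r : R) : set (borelRn R d) := ball (0 : 'rV[R]_d) r.
have mB r : measurable (B r) by apply: open_measurable_Rn; exact: ball_open.
have iB r : 0 < r -> (\int[leb]_z (\1_(B r) z)%:E = ((2 * r) ^+ d)%:E)%E.
  by move=> r0; rewrite integral_indic// setIT; exact: lebesgueRn_ball.
(* [u k] dominates the integrand on the k-th shell: there [enorm z] and b^k agree up to the factor
   [K], made of the 2 of the shell and the d + 1 between the norms. The radius 3 b^k makes the open
   ball contain the closed bound 2 b^k. *)
pose u k (z : borelRn R d) : \bar R :=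
  ((c * (b ^+ k) `^ p)%:E * (\1_(B (3 * b ^+ k)) z)%:E)%E.
have cb0 k : 0 <= c * (b ^+ k) `^ p by rewrite mulr_ge0// powR_ge0.
have u0 k z : (0 <= u k z)%E by rewrite mule_ge0// lee_fin.
have mi r E : measurable_fun E (fun z : borelRn R d => (\1_(B r) z : R)%:E).
  by apply/measurable_EFinP; exact: measurable_indic.
have mu_ E k : measurable_fun E (u k) by apply: measurable_funeM.
have ms E : measurable_fun E (fun z => \sum_(0 <= k <oo) u k z)%E.
  by apply: ge0_emeasurable_sum => // k z _ _.
have s0 z : (0 <= \sum_(0 <= k <oo) u k z)%E by apply: nneseries_ge0.
(* The indicator covers z = 0, which lies in no shell; there the integrand is 0 or, when p = 0,
   1. *)
pose g z : \bar R := ((\1_(B 1) z)%:E + \sum_(0 <= k <oo) u k z)%E.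
have g0 z : (0 <= g z)%E by rewrite adde_ge0// lee_fin.
have mg E : measurable_fun E g by exact: emeasurable_funD.
apply: (@le_lt_trans _ _ (\int[leb]_(z in D) g z)%E).
  apply: ge0_le_integral => //.
  - by move=> z _; rewrite lee_fin powR_ge0.
  - exact: measurable_enorm_powR.
  move=> z Dz; rewrite /g; have [z0|z0] := eqVneq (z : 'rV[R]_d) 0.
    apply: (@le_trans _ _ 1%E); last first.
      rewrite indicE mem_set ?leeDl// /B z0; exact: ballxx.
    rewrite lee_fin; have /eqP -> : enorm z == 0 by rewrite norm_eq0_enorm z0.
    by have [->|p0] := eqVneq p 0; rewrite ?powRr0// powR0.
  have [k [k1 k2]] := Dk z Dz z0.
  apply: (@le_trans _ _ (\sum_(0 <= k <oo) u k z)%E); last first.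
    by rewrite leeDr// lee_fin.
  apply: le_trans (nneseries_lim_ge k.+1 _); last by move=> *; exact: u0.
  rewrite big_nat_recr//=; apply: (@le_trans _ _ (u k z)); last first.
    by rewrite leeDr// sume_ge0.
  have bk : 0 < b ^+ k by rewrite exprn_gt0.
  rewrite /u indicE mem_set; last first.
    rewrite /B -ball_normE/= sub0r normrN (le_lt_trans k2)// ltr_pM2r//.
    by rewrite ltr_nat.
  rewrite mule1 lee_fin powR_comparable//.
  - by rewrite lt_neqAle eq_sym norm_eq0_enorm z0 enorm_ge0.
  - rewrite (le_trans (enorm_le_norm _ _))// /K (mulrC 2) -mulrA ler_wpM2l//.
  - rewrite (le_trans k1)// /K -mulrA ler_wpM2l//.
    rewrite (le_trans (ler_norm_enorm _ _))// ler_peMl ?enorm_ge0//.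
    by rewrite ler1n.
apply: (@le_lt_trans _ _ (\int[leb]_z g z)%E).
  by apply: ge0_subset_integral.
rewrite ge0_integralD//.
rewrite iB// lte_add_pinfty//; first exact: ltry.
rewrite integral_nneseries//.
(* Height c b^(kp) times volume (6 b^k)^d gives a geometric series of ratio b^(p + d). *)
have -> : (\sum_(0 <= k <oo) \int[leb]_x u k x =
    \sum_(0 <= k <oo) (c * 6 ^+ d * (b `^ (p + d%:R)) ^+ k)%:E)%E.
  apply: eq_eseriesr => k _; rewrite ge0_integralZl_EFin//.
  have bk : 0 < b ^+ k by rewrite exprn_gt0.
  rewrite iB ?mulr_gt0// -EFinM; congr (_%:E).
  have -> : 2 * (3 * b ^+ k) = 6 * b ^+ k by ring.
  rewrite exprMn mulrACA; congr (_ * _).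
  rewrite -[_ ^+ d]powR_mulrn ?ltW// -powRD ?(gt_eqF bk) ?implybT//.
  by rewrite -[_ ^+ k]powR_mulrn ?ltW// -[RHS]powR_mulrn ?powR_ge0// -!powRrM mulrC.
apply: nneseries_geometric_lty => //; [by rewrite mulr_ge0|by rewrite powR_gt0].
Qed.

Lemma measurable_norm_ge1 :
  measurable ([set z | 1 <= `|z|] : set (borelRn R d)).
Proof.
rewrite -[X in measurable X]setTI (_ : [set z | _] =
  (fun z : 'rV[R]_d => `|z|) @^-1` `[1, +oo[%classic).
  by apply: measurable_norm_Rn => //; exact: measurable_itv.
by apply/seteqP; split => z /=; rewrite in_itv/= andbT.
Qed.

Lemma integral_enorm_powR_tail (p : R) : p + d%:R < 0 ->
  (\int[leb]_(z in [set z | (1 <= `|z|)%R]) (enorm z `^ p)%:E < +oo)%E.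
Proof.
move=> pd; apply: (@integral_enorm_powR_shells 2) => //.
- rewrite -(opprK (_ + _)) powRN invf_lt1 ?powR_gt0//.
  have := @gt0_ltr_powR R (- (p + d%:R)) _ 1 2; rewrite powR1; apply.
  + by rewrite oppr_gt0.
  + by rewrite nnegrE.
  + by rewrite nnegrE.
  + by rewrite ltr1n.
- exact: measurable_norm_ge1.
move=> z /= z1 _; have [k [k1 k2]] := dyadic_scale _ z1; exists k; split=> //.
by rewrite (le_trans k1)// ler_peMl// ler1n.
Qed.

Lemma integral_enorm_powR_near0 (p : R) : 0 < p + d%:R ->
  (\int[leb]_(z in ~` [set z | (1 <= `|z|)%R]) (enorm z `^ p)%:E < +oo)%E.
Proof.
move=> pd; apply: (@integral_enorm_powR_shells 2^-1) => //.
- have := @gt0_ltr_powR R _ pd 2^-1 1; rewrite powR1; apply.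
  + by rewrite nnegrE.
  + by rewrite nnegrE.
  + by rewrite invf_lt1 ?ltr1n.
- by apply: measurableC; exact: measurable_norm_ge1.
move=> z /= /negP; rewrite -ltNge => z1 z0.
have nz : 0 < `|z| by rewrite normr_gt0.
have z1' : 1 <= `|z|^-1 by rewrite invf_ge1// ltW.
have [k [k1 k2]] := dyadic_scale _ z1'; exists k; rewrite exprVn.
have k0 : 0 < 2 ^+ k :> R by rewrite exprn_gt0.
split.
  rewrite -[leRHS]invrK lef_pV2 ?posrE ?invr_gt0 ?mulr_gt0// invfM.
  by rewrite ler_pdivrMl.
rewrite -[leLHS]invrK -[leRHS]invrK lef_pV2 ?posrE ?invr_gt0 ?mulr_gt0 ?invr_gt0//.
by rewrite invfM invrK (le_trans _ k1)// ler_piMl ?(ltW k0)// invf_le1 ?ler1n.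
Qed.
End power_integrals.

Lemma powR_div {R : realType} (x y p : R) : 0 <= x -> 0 <= y ->
  (x / y) `^ p = x `^ p / y `^ p.
Proof.
by move=> x0 y0; rewrite powRM ?invr_ge0// -(powR_inv1 y0) powRAC powR_inv1 ?powR_ge0.
Qed.

(** * Pointwise decay of a bounded Hölder function from a weighted integral *)

Section decay.
Context {R : realType} {d : nat}.
Local Notation leb := (lebesgueRn R d).
Variables (phi : 'rV[R]_d -> R) (M C alpha : R).
Hypotheses (phi0 : forall z, 0 <= phi z) (phiM : forall z, phi z <= M).
Hypotheses (M0 : 0 < M) (C0 : 0 < C) (alpha0 : 0 < alpha).
Hypothesis phiC : forall x y, `|phi x - phi y| <= C * enorm (x - y) `^ alpha.

Lemma hoelder_continuous_fun : continuous phi.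
Proof.
move=> x A /nbhs_ballP[e /= e0 eA].
(* Solves C ((d + 1) del)^alpha = e; the factor d + 1 passes from the sup norm to the Euclidean
   one. *)
pose del := (e / C) `^ alpha^-1 / d.+1%:R.
have del0 : 0 < del by rewrite divr_gt0// powR_gt0// divr_gt0.
apply: filterS (nbhsx_ballx x _ del0) => y; rewrite -ball_normE/= => xy.
apply: eA; rewrite -ball_normE/= (le_lt_trans (phiC _ _))//.
have eC0 : 0 <= e / C by rewrite divr_ge0// ltW.
rewrite -ltr_pdivlMl// mulrC -[ltRHS](powRr1 eC0).
rewrite -(mulVf (lt0r_neq0 alpha0)) powRrM.
rewrite gt0_ltr_powR ?nnegrE ?enorm_ge0 ?powR_ge0//.
by rewrite (le_lt_trans (enorm_le_norm _ _))// -ltr_pdivlMl// mulrC.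
Qed.

Lemma measurable_phi (D : set (borelRn R d)) : measurable_fun D (phi : borelRn R d -> R).
Proof.
by apply: measurable_funTS; apply: measurable_continuous_Rn; exact: hoelder_continuous_fun.
Qed.

Lemma measurable_energy_density (p q : R) (D : set (borelRn R d)) :
  measurable_fun D (fun z : borelRn R d => (phi z `^ p * enorm z `^ q)%:E).
Proof.
apply/measurable_EFinP; apply: measurable_funM; last first.
  by apply/measurable_EFinP; exact: measurable_enorm_powR.
exact: (measurableT_comp (measurable_powR p) (measurable_phi D)).
Qed.

(** The integral over a ball about z is at least the density at z, up to constants, times the volume
    of the ball, and the volume supplies the extra d / alpha in the exponent. The restriction to |z|
    >= rho keeps the ball away from the origin, where the weight is not comparable with its value at
    z. *)
Lemma decay_of_integrable (p q : R) : 0 < p ->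
  (\int[leb]_z (phi z `^ p * enorm z `^ q)%:E < +oo)%E ->
  exists B rho, forall z : 'rV[R]_d, rho <= `|z| ->
    phi z `^ (p + d%:R / alpha) * enorm z `^ q <= B.
Proof.
move=> p0 Ioo.
set f := (fun z : borelRn R d => (phi z `^ p * enorm z `^ q)%:E) in Ioo.
have f0 z : (0 <= f z)%E by rewrite lee_fin mulr_ge0 ?powR_ge0.
have I0 : (0 <= \int[leb]_z f z)%E by apply: integral_ge0.
have Ifin : (\int[leb]_z f z)%E \is a fin_num by rewrite ge0_fin_numE.
pose I := fine (\int[leb]_z f z)%E.
have I0' : 0 <= I by rewrite fine_ge0.
(* Within sup-norm distance [rad u], the Hölder bound lets [phi] change by at most u / 2. *)
pose rad u := (u / (2 * C)) `^ alpha^-1 / d.+1%:R.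
pose K : R := 2 * d.+1%:R.
have K1 : 1 <= K by rewrite /K -natrM ler1n.
have K0 : 0 < K by rewrite (lt_le_trans _ K1).
have C20 : 0 < 2 * C by rewrite mulr_gt0.
(* The first factor pays for halving [phi z], the second for moving the weight from z to w, the last
   two for the volume of the ball. *)
pose cst0 := 2 `^ p * K `^ `|q| * (2 * C) `^ (d%:R / alpha) * (d.+1%:R / 2) ^+ d.
exists (I * cst0), (2 * rad M) => z zrad.
have pd0 : 0 < p + d%:R / alpha by rewrite ltr_wpDr// divr_ge0// ltW.
have cst00 : 0 <= cst0.
  by rewrite !mulr_ge0 ?powR_ge0// exprn_ge0// divr_ge0.
(* If [phi z] vanishes the ball degenerates, but the bound is trivial. *)
have := phi0 z; rewrite le_eqVlt => /orP[/eqP <-|phiz].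
  by rewrite powR0 ?gt_eqF// mul0r mulr_ge0.
have r0 : 0 < rad (phi z) by rewrite divr_gt0// powR_gt0// divr_gt0.
have rM : rad (phi z) <= rad M.
  rewrite ler_pM2r ?invr_gt0// ge0_ler_powR ?nnegrE ?divr_ge0 ?invr_ge0//; do ?exact: ltW.
  by rewrite ler_pM2r ?invr_gt0.
have rM0 : 0 < rad M by rewrite (lt_le_trans r0).
have z0 : 0 < `|z| by rewrite (lt_le_trans _ zrad)// mulr_gt0.
pose c := (phi z / 2) `^ p * (enorm z `^ q / K `^ `|q|).
have c0 : 0 <= c by rewrite mulr_ge0 ?divr_ge0 ?powR_ge0.
have cf w : ball z (rad (phi z)) w -> (c%:E <= f w)%E.
  rewrite -ball_normE/= => zw; rewrite lee_fin ler_pM ?powR_ge0 ?divr_ge0 ?powR_ge0//.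
    rewrite ge0_ler_powR ?nnegrE ?divr_ge0 ?(ltW p0)//.
    have : `|phi z - phi w| <= phi z / 2.
      have -> : phi z / 2 = C * ((phi z / (2 * C)) `^ alpha^-1) `^ alpha.
        rewrite -powRrM mulVf ?gt_eqF// powRr1 ?divr_ge0 ?(ltW C20)//.
        by field; rewrite gt_eqF.
      rewrite (le_trans (phiC _ _))// ler_pM2l//.
      rewrite ge0_ler_powR ?nnegrE ?enorm_ge0 ?powR_ge0 ?(ltW alpha0)//.
      by rewrite (le_trans (enorm_le_norm _ _))// -ler_pdivlMl// mulrC ltW.
    by rewrite ler_norml => /andP[_]; lra.
  (* The radius is at most rho / 2, hence at most |z| / 2, so |w| and |z| agree up to a factor 2. *)
  have zw' : 2 * `|z - w| <= `|z|.
    by rewrite (le_trans _ zrad)// ler_pM2l// (le_trans _ rM)// ltW.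
  have h1 : `|w| <= 2 * `|z|.
    have := ler_normB z (z - w).
    rewrite (_ : z - (z - w) = w); last by rewrite opprB addrC subrK.
    have := normr_ge0 (z - w); move: zw'. lra.
  have h2 : `|z| <= 2 * `|w|.
    by have := ler_normD (z - w) w; rewrite subrK; lra.
  have w0 : 0 < `|w| by lra.
  rewrite ler_pdivrMr ?powR_gt0// mulrC powR_comparable//.
  - exact: lt_le_trans (ler_norm_enorm _ _).
  - exact: lt_le_trans (ler_norm_enorm _ _).
  - rewrite (le_trans (enorm_le_norm _ _))// /K (mulrC 2) -mulrA ler_pM2l//.
    by rewrite (le_trans h2)// ler_pM2l// ler_norm_enorm.
  - rewrite (le_trans (enorm_le_norm _ _))// /K (mulrC 2) -mulrA ler_pM2l//.
    by rewrite (le_trans h1)// ler_pM2l// ler_norm_enorm.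
have mB : measurable (ball z (rad (phi z)) : set (borelRn R d)).
  by apply: open_measurable_Rn; exact: ball_open.
have mf D : measurable_fun D f by exact: measurable_energy_density.
have : (c%:E * ((2 * rad (phi z)) ^+ d)%:E <= I%:E)%E.
  rewrite fineK//; apply: (@le_trans _ _ (\int[leb]_(w in ball z (rad (phi z))) f w)%E).
    apply: (@le_trans _ _ (\int[leb]_(w in ball z (rad (phi z))) (cst c%:E w))%E).
      by rewrite integral_cst//= -(lebesgueRn_ball _ z _ r0).
    apply: ge0_le_integral => //.
  by apply: ge0_subset_integral.
rewrite -EFinM lee_fin => cI.
have cst0gt : 0 < cst0.
  by rewrite !mulr_gt0 ?powR_gt0// exprn_gt0// divr_gt0.
rewrite -ler_pdivrMr// (le_trans _ cI)// le_eqVlt; apply/orP; left; apply/eqP.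
(* With the volume written as a power of [phi z], c times the volume is exactly the quantity to be
   bounded, divided by [cst0]. *)
have -> : (2 * rad (phi z)) ^+ d =
    phi z `^ (d%:R / alpha) / (2 * C) `^ (d%:R / alpha) / (d.+1%:R / 2) ^+ d.
  rewrite -powR_div ?(ltW C20)// mulrC -exprVn mulrC invf_div.
  rewrite (mulrC d%:R) powRrM powR_mulrn ?powR_ge0// -exprMn /rad; congr (_ ^+ _).
  by rewrite mulrCA mulrA mulrAC.
rewrite /c /cst0 powR_div// powRD ?(gt_eqF phiz) ?implybT//.
have := powR_gt0 p (ltr0n R 2); have := powR_gt0 `|q| K0.
have := powR_gt0 (d%:R / alpha) C20.
have : 0 < (d.+1%:R / 2 : R) ^+ d by rewrite exprn_gt0// divr_gt0.
move: (_ ^+ d) (K `^ _) (2 `^ _) ((2 * C) `^ _) => a1 a2 a3 a4 a10 a20 a30 a40.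
by field; rewrite !gt_eqF.
Qed.
End decay.

(** * Boundedness of the Fourier transform, and finiteness criteria for the energies *)

Section fourier_transform.
Context {R : realType} {d : nat}.
Variable mu : {finite_measure set (borelRn R d) -> \bar R}.

Definition fourier_abs z : R := Normc.normc (fourier mu z).
Local Notation phi := fourier_abs.

Lemma fourier_abs_ge0 z : 0 <= phi z.
Proof. exact: sqrtr_ge0. Qed.

Lemma normr_Rintegral_le_mass (f : borelRn R d -> R) :
  measurable_fun setT f -> (forall x, `|f x| <= 1) ->
  `|\int[mu]_x f x| <= fine (mu setT).
Proof.
move=> mf f1.
have mufin : (mu setT < +oo)%E by rewrite -ge0_fin_numE// fin_num_measure.
have bi (g : borelRn R d -> R) : measurable_fun setT g -> (forall x, `|g x| <= 1) ->
    mu.-integrable setT (EFin \o g).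
  move=> mg g1; apply: measurable_bounded_integrable => //.
  exists 1; split; first exact: num_real.
  by move=> k k1 x _ /=; rewrite (le_trans (g1 x))// ltW.
rewrite (le_trans (le_normr_Rintegral _ (bi f mf f1)))//.
apply: (@le_trans _ _ (\int[mu]_x (cst 1 x))).
  apply: le_Rintegral => //; apply: bi => //.
  - exact: measurableT_comp.
  - by move=> x; rewrite normr_id.
  - by move=> x /=; rewrite normr1.
by rewrite Rintegral_cst// mul1r.
Qed.

Lemma fourier_bounded :
  exists2 M, 0 < M & forall z, phi z <= M.
Proof.
(* One mass each for the real and the imaginary part; the 1 makes the bound positive even for the
   zero measure. *)
exists (fine (mu setT) + fine (mu setT) + 1) => [|z].
  by rewrite ltr_wpDl// addr_ge0// fine_ge0.
rewrite ler_wpDr// /fourier_abs /fourier /cintegral /Normc.normc.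
have mt : measurable_fun [set: borelRn R d] (fun x : 'rV[R]_d => - (2 * pi * dotp z x)).
  apply: measurableT_comp => //; apply: measurable_funM => //.
  exact: measurable_dotp.
set a := Rintegral _ _ _; set b := Rintegral _ _ _.
apply: (@le_trans _ _ (`|a| + `|b|)).
  rewrite -[leRHS]ger0_norm ?addr_ge0// -sqrtr_sqr ler_wsqrtr//.
  rewrite sqrrD !real_normK ?num_real// lerD2r lerDl.
  by rewrite mulrn_wge0// mulr_ge0.
apply: lerD; apply: normr_Rintegral_le_mass => /=.
- apply: (measurableT_comp _ mt); apply: continuous_measurable_fun.
  exact: continuous_cos.
- by move=> x; rewrite ler_norml cos_geN1 cos_le1.
- apply: (measurableT_comp _ mt); apply: continuous_measurable_fun.
  exact: continuous_sin.
- by move=> x; rewrite ler_norml sin_geN1 sin_le1.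
Qed.

Lemma energy0_ltyP s : (energy mu s 0 < +oo)%E <->
  exists B, forall z, phi z ^+ 2 * enorm z `^ s <= B.
Proof.
rewrite /energy eqxx; split => [|[B Bs]].
  set S := ereal_sup _ => Soo; exists (fine S) => z.
  have Sz : ((phi z ^+ 2 * enorm z `^ s)%:E <= S)%E.
    by apply: ereal_sup_ubound; exists z.
  by rewrite -lee_fin fineK// fin_real// Soo andbT (lt_le_trans _ Sz)// ltNyr.
apply: (@le_lt_trans _ _ B%:E); last exact: ltry.
by apply: ge_ereal_sup => _ [z _ <-]; rewrite lee_fin; exact: Bs.
Qed.

Lemma energy_ltyP s theta : 0 < theta -> (energy mu s theta < +oo)%E <->
  (\int[lebesgueRn R d]_z (phi z `^ (2 / theta)
     * enorm z `^ (s / theta - d%:R))%:E < +oo)%E.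
Proof.
move=> t0; rewrite /energy gt_eqF//; split; last exact: poweR_lty.
by apply: lty_poweRy; rewrite gt_eqF.
Qed.

Lemma spectrum_ge0 theta : (0 <= fourier_spectrum mu theta)%E.
Proof. by rewrite /fourier_spectrum le_max lexx. Qed.

Lemma spectrum_ge s theta : 0 <= s -> (energy mu s theta < +oo)%E ->
  (s%:E <= fourier_spectrum mu theta)%E.
Proof.
move=> s0 soo; rewrite /fourier_spectrum le_max; apply/orP; right.
by apply: ereal_sup_ubound; exists s.
Qed.

Lemma spectrum_le theta x : (0 <= x)%E ->
  (forall s, 0 <= s -> (energy mu s theta < +oo)%E -> (s%:E <= x)%E) ->
  (fourier_spectrum mu theta <= x)%E.
Proof.
move=> x0 h; rewrite /fourier_spectrum ge_max x0/=.
by apply: ge_ereal_sup => _ [s [s0 soo] <-]; exact: h.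
Qed.

(** Makes s = 0 admissible at theta = 0, so that the interpolation inequality always has a left
    endpoint. *)
Lemma energy00_lty : (energy mu 0 0 < +oo)%E.
Proof.
have [M M0 phiM] := fourier_bounded.
apply/energy0_ltyP; exists (M ^+ 2) => z; rewrite powRr0 mulr1.
by rewrite ler_sqr ?nnegrE ?sqrtr_ge0// ltW.
Qed.

(** * Comparison of energies at different parameters *)

Variables (alpha : R).
Hypotheses (alpha_gt0 : 0 < alpha).
Hypothesis fourier_hoelder : hoelder_continuous alpha (fourier mu).
Local Notation phi0 := fourier_abs_ge0.

(** Reverse triangle inequality: the modulus inherits the Hölder bound. *)
Lemma fourier_abs_hoelder : exists2 C : R, 0 < C &
  forall x y, `|phi x - phi y| <= C * enorm (x - y) `^ alpha.
Proof.
have [C C0 hC] := fourier_hoelder; exists C => // x y.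
apply: le_trans (hC x y); rewrite ler_norml; apply/andP; split.
  rewrite lerNl opprB lerBlDr.
  have := le_normcD (fourier mu y - fourier mu x : Rcomplex R) (fourier mu x).
  rewrite subrK => /le_trans; apply; rewrite lerD2r -normcN opprB//.
rewrite lerBlDr.
by have := le_normcD (fourier mu x - fourier mu y : Rcomplex R) (fourier mu y); rewrite subrK.
Qed.

Let measurable_density (p q : R) (D : set (borelRn R d)) :
  measurable_fun D (fun z : borelRn R d => (phi z `^ p * enorm z `^ q)%:E).
Proof.
have [C C0 hC] := fourier_abs_hoelder.
exact: (measurable_energy_density phi C alpha C0 alpha_gt0 hC).
Qed.

(** The decay estimate bounds phi^e |z|^q with e = 2 / theta + d / alpha and q = s / theta - d.
    Raising it to the power 2 / e leaves phi^2, and t = 2 q / e. *)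
Lemma energy0_of_energy s theta (t := (s - d%:R * theta) / (1 + d%:R * theta / (2 * alpha))) :
  0 < theta -> 0 <= t -> (energy mu s theta < +oo)%E -> (energy mu t 0 < +oo)%E.
Proof.
move=> th0 t0 /(energy_ltyP _ _ th0) soo; apply/energy0_ltyP.
have [C C0 hC] := fourier_abs_hoelder.
have [M M0 phiM] := fourier_bounded.
have p0 : 0 < 2 / theta by rewrite divr_gt0.
have [B [rho h]] := decay_of_integrable phi M C alpha phi0 phiM M0 C0 alpha_gt0 hC _ _ p0 soo.
set e := 2 / theta + _ in h; set q := s / theta - _ in h.
have e0 : 0 < e by rewrite ltr_wpDr// divr_ge0// ltW.
(* The first term serves |z| >= rho; the second serves |z| < rho, where phi <= M and t >= 0
   suffice. *)
exists (`|B| `^ (2 / e) + M ^+ 2 * (d.+1%:R * `|rho|) `^ t) => z.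
have [rz|rz] := leP rho `|z|.
  rewrite ler_wpDr ?mulr_ge0 ?powR_ge0 ?(ltW M0)//.
  have -> : phi z ^+ 2 * enorm z `^ t = (phi z `^ e * enorm z `^ q) `^ (2 / e).
    rewrite powRM ?powR_ge0// -!powRrM -powR_mulrn ?phi0//.
    congr (_ `^ _ * _ `^ _); first by rewrite mulrCA divff ?mulr1// gt_eqF.
    rewrite /t /q /e; field.
    by rewrite !gt_eqF// ltr_wpDr ?mulr_ge0 ?mulr_gt0 ?(ltW th0).
  rewrite ge0_ler_powR ?nnegrE ?mulr_ge0 ?powR_ge0 ?divr_ge0 ?invr_ge0 ?(ltW e0)//.
  by rewrite (le_trans (h _ rz))// ler_norm.
rewrite ler_wpDl ?powR_ge0// ler_pM ?sqr_ge0 ?powR_ge0//.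
  by rewrite ler_sqr ?nnegrE ?phi0 ?phiM ?(ltW M0).
rewrite ge0_ler_powR ?nnegrE ?enorm_ge0 ?t0 ?mulr_ge0//.
rewrite (le_trans (enorm_le_norm _ _))// ler_pM2l//.
by rewrite (le_trans (ltW rz))// ler_norm.
Qed.

Let leb_norm_ge1_setT :
  [set z : 'rV[R]_d | 1 <= `|z|] `|` ~` [set z | 1 <= `|z|] = setT.
Proof. exact: setUv. Qed.

(** The domain is split at |z| = 1. Near the origin, boundedness of [phi] and t > 0 suffice; at
    infinity, the loss from s to t leaves a power of |z| with exponent below -d. *)
Lemma energy_lt_mono s t x y : 0 <= x -> x < y -> 0 < t -> t < s ->
  (energy mu s x < +oo)%E -> (energy mu t y < +oo)%E.
Proof.
move=> x0 xy t0 ts soo; have y0 : 0 < y by exact: le_lt_trans xy.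
have [M M0 phiM] := fourier_bounded.
apply/(energy_ltyP _ _ y0).
rewrite -leb_norm_ge1_setT ge0_integral_setU//=; last 4 first.
- exact: measurable_norm_ge1.
- by apply: measurableC; exact: measurable_norm_ge1.
- by move=> z _; rewrite lee_fin mulr_ge0 ?powR_ge0.
- by apply/disj_setPS; rewrite setICr.
have near0 : (\int[lebesgueRn R d]_(z in ~` [set z | (1 <= `|z|)%R])
    (phi z `^ (2 / y) * enorm z `^ (t / y - d%:R))%:E < +oo)%E.
  apply: (@le_lt_trans _ _ (\int[lebesgueRn R d]_(z in ~` [set z | (1 <= `|z|)%R])
    ((M `^ (2 / y))%:E * (enorm z `^ (t / y - d%:R))%:E))%E).
    apply: ge0_le_integral.
    - by apply: measurableC; exact: measurable_norm_ge1.
    - by move=> z _; rewrite lee_fin mulr_ge0 ?powR_ge0.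
    - exact: measurable_density.
    - by apply: measurable_funeM; exact: measurable_enorm_powR.
    move=> z _; rewrite -EFinM lee_fin ler_wpM2r ?powR_ge0//.
    by rewrite ge0_ler_powR ?nnegrE ?phi0 ?phiM ?divr_ge0 ?invr_ge0 ?(ltW y0) ?(ltW M0).
  rewrite ge0_integralZl_EFin ?powR_ge0//.
  - rewrite lte_mul_pinfty ?lee_fin ?powR_ge0//.
    by apply: integral_enorm_powR_near0; rewrite subrK divr_gt0.
  - by apply: measurableC; exact: measurable_norm_ge1.
  - by move=> z _; rewrite lee_fin powR_ge0.
  - exact: measurable_enorm_powR.
rewrite lte_add_pinfty//.
have E1 (z : 'rV[R]_d) : 1 <= `|z| -> 0 < enorm z.
  by move=> z1; rewrite (lt_le_trans _ (ler_norm_enorm _ _))// (lt_le_trans _ z1).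
move: x0; rewrite le_eqVlt => /orP[/eqP xE|x0].
  move: soo; rewrite -xE => /energy0_ltyP[B hB].
  apply: (@le_lt_trans _ _ (\int[lebesgueRn R d]_(z in [set z | (1 <= `|z|)%R])
    ((`|B| `^ y^-1)%:E * (enorm z `^ ((t - s) / y - d%:R))%:E))%E).
    apply: ge0_le_integral.
    - exact: measurable_norm_ge1.
    - by move=> z _; rewrite lee_fin mulr_ge0 ?powR_ge0.
    - exact: measurable_density.
    - by apply: measurable_funeM; exact: measurable_enorm_powR.
    move=> z /= /E1 z0; rewrite -EFinM lee_fin.
    (* The part |z|^(s / y) joins phi^(2 / y) to form the power 1 / y of the quantity bounded by
       B. *)
    rewrite (_ : t / y - d%:R = s / y + ((t - s) / y - d%:R)); last by ring.
    rewrite [_ `^ (s / y + _)]powRD ?(gt_eqF z0) ?implybT// mulrA ler_wpM2r ?powR_ge0//.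
    rewrite !powRrM powR_mulrn ?phi0// -powRM ?sqr_ge0 ?powR_ge0//.
    rewrite ge0_ler_powR ?nnegrE ?mulr_ge0 ?phi0 ?powR_ge0 ?invr_ge0 ?(ltW y0)//.
    by rewrite (le_trans (hB z))// ler_norm.
  rewrite ge0_integralZl_EFin ?powR_ge0//.
  - rewrite lte_mul_pinfty ?lee_fin ?powR_ge0//.
    apply: integral_enorm_powR_tail; rewrite subrK.
    by rewrite pmulr_llt0 ?invr_gt0// subr_lt0.
  - exact: measurable_norm_ge1.
  - by move=> z _; rewrite lee_fin powR_ge0.
  - exact: measurable_enorm_powR.
move: soo => /(energy_ltyP _ _ x0) soo.
(* The exponent for which the weights x / y and 1 - x / y turn the density at x and |z|^r into the
   density at y; s > t puts it below -d. *)
pose r := - (s - t) / (y - x) - d%:R.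
apply: (@le_lt_trans _ _ (\int[lebesgueRn R d]_(z in [set z | (1 <= `|z|)%R])
  ((phi z `^ (2 / x) * enorm z `^ (s / x - d%:R))%:E + (enorm z `^ r)%:E))%E).
  apply: ge0_le_integral.
  - exact: measurable_norm_ge1.
  - by move=> z _; rewrite lee_fin mulr_ge0 ?powR_ge0.
  - exact: measurable_density.
  - by apply: emeasurable_funD; [exact: measurable_density|exact: measurable_enorm_powR].
  move=> z /= /E1 z0; rewrite -EFinD lee_fin.
  have -> : phi z `^ (2 / y) * enorm z `^ (t / y - d%:R) =
      (phi z `^ (2 / x) * enorm z `^ (s / x - d%:R)) `^ (x / y)
      * (enorm z `^ r) `^ (1 - x / y).
    rewrite powRM ?powR_ge0// -!powRrM -mulrA -powRD ?(gt_eqF z0) ?implybT//.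
    have yx : y - x != 0 by rewrite gt_eqF// subr_gt0.
    by congr (_ `^ _ * _ `^ _); rewrite /r; field; rewrite ?yx !gt_eqF.
  apply: powR_prod_le_sum; rewrite ?mulr_ge0 ?powR_ge0 ?divr_ge0 ?invr_ge0 ?(ltW x0) ?(ltW y0)//.
    by rewrite subr_ge0 ler_pdivrMr// mul1r ltW.
  by rewrite addrC subrK.
rewrite ge0_integralD.
- rewrite lte_add_pinfty//.
    apply: le_lt_trans soo; apply: ge0_subset_integral => //.
    + exact: measurable_norm_ge1.
    + by move=> z _; rewrite lee_fin mulr_ge0 ?powR_ge0.
  apply: integral_enorm_powR_tail; rewrite subrK.
  by rewrite pmulr_llt0 ?invr_gt0 ?oppr_lt0 ?subr_gt0.
- exact: measurable_norm_ge1.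
- by move=> z _; rewrite lee_fin mulr_ge0 ?powR_ge0.
- exact: measurable_density.
- by move=> z _; rewrite lee_fin powR_ge0.
- exact: measurable_enorm_powR.
Qed.

(** Away from the origin the density at x is the density at y times the power 1 / x - 1 / y of phi^2
    |z|^s0, which is bounded; no Hölder inequality for integrals is required. *)
Lemma energy_interpolate0 s0 s1 x y : 0 < x -> x < y ->
  (energy mu s0 0 < +oo)%E -> (energy mu s1 y < +oo)%E ->
  (energy mu ((1 - x / y) * s0 + x / y * s1) x < +oo)%E.
Proof.
move=> x0 xy /energy0_ltyP[B hB]; have y0 : 0 < y by exact: lt_trans xy.
move=> /(energy_ltyP _ _ y0) s1oo; apply/(energy_ltyP _ _ x0).
have [M M0 phiM] := fourier_bounded.
pose u := x^-1 - y^-1.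
have u0 : 0 < u by rewrite subr_gt0 ltf_pV2.
pose U : set (borelRn R d) := ball (0 : 'rV[R]_d) 1.
have mU : measurable U by apply: open_measurable_Rn; exact: ball_open.
have mi : measurable_fun [set: borelRn R d] (fun z : borelRn R d => (\1_U z : R)%:E).
  by apply/measurable_EFinP; exact: measurable_indic.
apply: (@le_lt_trans _ _ (\int[lebesgueRn R d]_z
  ((`|B| `^ u)%:E * (phi z `^ (2 / y) * enorm z `^ (s1 / y - d%:R))%:E
   + (M `^ (2 / x))%:E * (\1_U z)%:E))%E).
  apply: ge0_le_integral => //.
  - by move=> z _; rewrite lee_fin mulr_ge0 ?powR_ge0.
  - by apply: emeasurable_funD; apply: measurable_funeM.
  move=> z _; rewrite -!EFinM -EFinD lee_fin.
  (* At z = 0 the law of exponents for |z| may fail. The indicator of [U] absorbs this point, which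
     carries mass when d = 0. *)
  have [z0|z0] := eqVneq (z : 'rV[R]_d) 0.
    rewrite ler_wpDl ?mulr_ge0 ?powR_ge0//.
    rewrite indicE mem_set; last by rewrite /U z0; exact: ballxx.
    rewrite ler_pM ?powR_ge0//.
      by rewrite ge0_ler_powR ?nnegrE ?phi0 ?phiM ?divr_ge0 ?invr_ge0 ?(ltW x0) ?(ltW M0).
    have /eqP -> : enorm z == 0 by rewrite norm_eq0_enorm z0.
    set p := _ - _; have [->|p0] := eqVneq p 0; first by rewrite powRr0.
    by rewrite powR0// ler01.
  rewrite ler_wpDr ?mulr_ge0 ?powR_ge0//.
  have zn : enorm z != 0 by rewrite norm_eq0_enorm.
  have -> : phi z `^ (2 / x) * enorm z `^ (((1 - x / y) * s0 + x / y * s1) / x - d%:R) =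
      (phi z ^+ 2 * enorm z `^ s0) `^ u * (phi z `^ (2 / y) * enorm z `^ (s1 / y - d%:R)).
    rewrite powRM ?sqr_ge0 ?powR_ge0// -powR_mulrn ?phi0// -!powRrM mulrACA -!powRD ?zn ?implybT//.
      by congr (_ `^ _ * _ `^ _); rewrite /u; field; rewrite !gt_eqF.
    apply/implyP => /eqP; rewrite /u.
    have -> : 2 * (x^-1 - y^-1) + 2 / y = 2 / x by ring.
    by move=> /eqP; rewrite gt_eqF// divr_gt0.
  rewrite ler_wpM2r ?mulr_ge0 ?powR_ge0//.
  rewrite ge0_ler_powR ?nnegrE ?mulr_ge0 ?phi0 ?powR_ge0 ?(ltW u0)//.
  by rewrite (le_trans (hB z))// ler_norm.
rewrite ge0_integralD//.
- rewrite lte_add_pinfty//.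
    rewrite ge0_integralZl_EFin ?powR_ge0//.
    + by rewrite lte_mul_pinfty ?lee_fin ?powR_ge0.
    + by move=> z _; rewrite lee_fin mulr_ge0 ?powR_ge0.
  rewrite ge0_integralZl_EFin ?powR_ge0// integral_indic// setIT.
  rewrite lte_mul_pinfty ?lee_fin ?powR_ge0//.
  rewrite [X in (X < _)%E](_ : _ = ((2 * 1) ^+ d)%:E); first exact: ltry.
  exact: lebesgueRn_ball.
- by move=> z _; rewrite -EFinM lee_fin !mulr_ge0 ?powR_ge0.
- by apply: measurable_funeM; exact: measurable_density.
- by move=> z _; rewrite -EFinM lee_fin !mulr_ge0 ?powR_ge0.
- exact: measurable_funeM.
Qed.
End fourier_transform.

(** * Linear bound, monotonicity and concavity from 0 of the spectrum *)

Section spectrum.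
Context {R : realType} {d : nat}.
Variable mu : {finite_measure set (borelRn R d) -> \bar R}.
Variables (alpha : R).
Hypotheses (alpha_gt0 : 0 < alpha).
Hypothesis fourier_hoelder : hoelder_continuous alpha (fourier mu).
Local Notation spec := (fourier_spectrum mu).

(** For an admissible s, the t of [energy0_of_energy] is at most the Fourier dimension; solving for
    s gives the line. *)
Lemma spectrum_le_line theta : 0 <= theta ->
  (spec theta <= spec 0 + d%:R%:E * (1 + spec 0 * ((2 * alpha)^-1)%:E) * theta%:E)%E.
Proof.
rewrite le_eqVlt => /orP[/eqP <-|th0]; first by rewrite mule0 adde0.
have al0 : 0 <= (2 * alpha)^-1 by rewrite invr_ge0 mulr_ge0// ltW.
have rest0 : (0 <= d%:R%:E * (1 + spec 0 * ((2 * alpha)^-1)%:E) * theta%:E)%E.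
  by rewrite !mule_ge0 ?adde_ge0 ?mule_ge0 ?lee_fin ?spectrum_ge0 ?(ltW th0).
apply: spectrum_le => [|s s0 soo]; first by rewrite adde_ge0 ?spectrum_ge0.
have := spectrum_ge0 mu 0; have h t := @spectrum_ge R d mu t 0.
move: h rest0; case: (spec 0) => [D h _|h rest0 _|//].
- rewrite lee_fin => D0.
  rewrite -!(EFinM, EFinD) lee_fin.
  pose t := (s - d%:R * theta) / (1 + d%:R * theta / (2 * alpha)).
  have u0 : 0 < 1 + d%:R * theta / (2 * alpha).
    by rewrite ltr_wpDr// !mulr_ge0 ?(ltW th0).
  have [t0|t0] := leP 0 t.
    have tD : t <= D.
      by rewrite -lee_fin; apply: h => //; exact: (energy0_of_energy mu alpha alpha_gt0).
    rewrite ler_pdivrMr// in tD.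
    rewrite -lerBlDr -subr_ge0; rewrite -subr_ge0 in tD; apply: le_trans tD _.
    rewrite le_eqVlt; apply/orP; left; apply/eqP; field.
    by rewrite gt_eqF.
  (* A negative t means s < d theta, already below the line. *)
  move: t0; rewrite pmulr_llt0 ?invr_gt0// subr_lt0 => /ltW/le_trans; apply.
  rewrite mulrDr mulr1 mulrDl addrCA lerDl addr_ge0// !mulr_ge0 ?(ltW th0)//.
by rewrite addye ?leey// gt_eqF// (lt_le_trans _ rest0)// ltNyr.
Qed.

Lemma spectrum_mono x y : 0 <= x -> x <= y -> (spec x <= spec y)%E.
Proof.
move=> x0; rewrite le_eqVlt => /orP[/eqP ->//|xy].
apply: spectrum_le => [|s s0 soo]; first exact: spectrum_ge0.
rewrite leNgt; apply/negP => sy.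
have := spectrum_ge0 mu y; have h t := @spectrum_ge R d mu t y.
move: h sy; case: (spec y) => [r h|//|//]; rewrite lte_fin lee_fin => rs r0.
(* [energy_lt_mono] needs a strict loss in s; the midpoint still exceeds the supremum r, a
   contradiction. *)
have t0 : 0 < (r + s) / 2 by lra.
have : (energy mu ((r + s) / 2) y < +oo)%E.
  by apply: (energy_lt_mono mu alpha alpha_gt0 fourier_hoelder s _ x) => //; lra.
by move=> /(h _ (ltW t0)); rewrite lee_fin; lra.
Qed.

(** The suprema in [energy_interpolate0] are taken one at a time: over s0 with s1 fixed, then over
    s1. *)
Lemma spectrum_concave0 x y a b c : 0 < x -> x < y ->
  spec 0 = a%:E -> spec x = b%:E -> spec y = c%:E ->
  (1 - x / y) * a + x / y * c <= b.
Proof.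
move=> x0 xy sa sb sc; have y0 : 0 < y by exact: lt_trans xy.
have l0 : 0 < x / y by rewrite divr_gt0.
have l1 : 0 < 1 - x / y by rewrite subr_gt0 ltr_pdivrMr// mul1r.
have h s0 s1 : 0 <= s0 -> 0 <= s1 -> (energy mu s0 0 < +oo)%E -> (energy mu s1 y < +oo)%E ->
    (1 - x / y) * s0 + x / y * s1 <= b.
  move=> s00 s10 e0 e1; rewrite -lee_fin -sb spectrum_ge//.
    by rewrite addr_ge0 // mulr_ge0 ?(ltW l0) ?(ltW l1).
  exact: (energy_interpolate0 mu alpha alpha_gt0).
have ab : a <= b by rewrite -lee_fin -sa -sb spectrum_mono// ltW.
have a0 : 0 <= a by rewrite -lee_fin -sa spectrum_ge0.
have ha s1 : 0 <= s1 -> (energy mu s1 y < +oo)%E -> (1 - x / y) * a + x / y * s1 <= b.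
  move=> s10 e1; rewrite -lerBrDr mulrC -ler_pdivlMr// -lee_fin -sa.
  apply: spectrum_le => [|s0 s00 e0].
    (* [spectrum_le] requires a nonnegative bound; the case s0 = 0 provides it. *)
    rewrite lee_fin divr_ge0 ?(ltW l1)// subr_ge0.
    by have := h 0 s1 (lexx _) s10 (energy00_lty mu) e1; rewrite mulr0 add0r.
  by rewrite lee_fin ler_pdivlMr// mulrC lerBrDr h.
rewrite -lerBrDl mulrC -ler_pdivlMr// -lee_fin -sc.
apply: spectrum_le => [|s1 s10 e1].
  rewrite lee_fin divr_ge0 ?(ltW l0)// subr_ge0 (le_trans _ ab)//.
  by rewrite ler_piMl// gerBl ltW.
by rewrite lee_fin ler_pdivlMr// mulrC lerBrDl ha.
Qed.
Hypothesis spec0_lty : (spec 0 < +oo)%E.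
Let slope : R := d%:R * (1 + fine (spec 0) * (2 * alpha)^-1).

Let spec0E : spec 0 = (fine (spec 0))%:E.
Proof. by rewrite fineK// ge0_fin_numE ?spectrum_ge0. Qed.

Let spectrum_le_slope theta : 0 <= theta ->
  (spec theta <= (fine (spec 0) + slope * theta)%:E)%E.
Proof.
move=> /spectrum_le_line h; apply: (le_trans h).
by rewrite spec0E /slope -!(EFinM, EFinD).
Qed.

Lemma spectrum_fin_num theta : 0 <= theta -> spec theta \is a fin_num.
Proof.
move=> th0; rewrite ge0_fin_numE ?spectrum_ge0//.
by apply: le_lt_trans (spectrum_le_slope _ th0) _; exact: ltry.
Qed.

(** For 0 < x < y, concavity from 0 reads x (g y - g x) <= (y - x) (g x - g 0), and the linear bound
    at x gives g x - g 0 <= slope x; cancelling x finishes. *)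
Lemma spectrum_increment x y : 0 <= x -> x <= y ->
  0 <= fine (spec y) - fine (spec x) <= slope * (y - x).
Proof.
pose g theta := fine (spec theta).
have gE theta : 0 <= theta -> spec theta = (g theta)%:E.
  by move=> th0; rewrite fineK// spectrum_fin_num.
have gslope theta : 0 <= theta -> g theta <= g 0 + slope * theta.
  by move=> th0; rewrite -lee_fin -gE// spectrum_le_slope.
move=> x0 xy; apply/andP; split.
  by rewrite subr_ge0 -lee_fin -!gE ?spectrum_mono// (le_trans x0).
move: x0; rewrite le_eqVlt => /orP[/eqP x0|x0].
  by move: xy; rewrite -x0 subr0 lerBlDl; exact: gslope.
move: xy; rewrite le_eqVlt => /orP[/eqP ->|xy]; first by rewrite !subrr mulr0.
have y0 : 0 < y by exact: lt_trans xy.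
have := spectrum_concave0 _ _ _ _ _ x0 xy
  (gE _ (lexx 0)) (gE _ (ltW x0)) (gE _ (ltW y0)).
rewrite -(ler_pM2l y0).
have -> : y * ((1 - x / y) * g 0 + x / y * g y) = (y - x) * g 0 + x * g y.
  by field; rewrite gt_eqF.
have yx : 0 < y - x by rewrite subr_gt0.
move=> concave; have steep := ler_wpM2l (ltW yx) (gslope _ (ltW x0)).
suff : x * (g y - g x) <= x * (slope * (y - x)) by rewrite ler_pM2l.
lra.
Qed.
End spectrum.

Local Open Scope ereal_scope.

Theorem theorem1p3 (R : realType) (d : nat) (alpha : R)
    (mu : {finite_measure set (borelRn R d) -> \bar R})
    (alpha_gt0 : (0 < alpha)%R) (alpha_le1 : (alpha <= 1)%R)
    (fourier_hoelder : hoelder_continuous alpha (fourier mu)) :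
  (forall theta : R, (0 <= theta <= 1)%R ->
     fourier_spectrum mu theta <=
       fourier_dim mu
       + d%:R%:E * (1 + fourier_dim mu * ((2 * alpha)^-1)%R%:E) * theta%:E) /\
  (fourier_dim mu < +oo ->
     (forall theta : R, (0 <= theta <= 1)%R ->
        fourier_spectrum mu theta \is a fin_num) /\
     (exists L : R, forall theta : R, (0 <= theta <= 1)%R ->
        `|fourier_spectrum mu theta - fourier_spectrum mu 0|
          <= (L * theta)%R%:E) /\
     [lipschitz (fine (fourier_spectrum mu theta)) | theta in `[0%R, 1%R]]).
Proof.
have line := spectrum_le_line mu _ alpha_gt0 fourier_hoelder.
split=> [theta /andP[th0 _]|spec0_lty]; first exact: line.
have fin := spectrum_fin_num mu _ alpha_gt0 fourier_hoelder spec0_lty.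
have incr := spectrum_increment mu _ alpha_gt0 fourier_hoelder spec0_lty.
set L := (d%:R * _)%R in incr.
split; first by move=> theta /andP[th0 _]; exact: fin.
split.
  exists L => theta /andP[th0 _].
  rewrite -(fineK (fin _ th0)) -(fineK (fin _ (lexx 0%R))) -EFinB lee_fin.
  by have /andP[/ger0_norm -> ] := incr _ _ (lexx 0%R) th0; rewrite subr0.
(* The library notion asks for the bound with every sufficiently large constant M; M >= L
   suffices. *)
rewrite /lipschitz_on; near=> M; move=> [x y] /=; rewrite !in_itv/= => -[].
move=> /andP[x0 _] /andP[y0 _].
have LM : (L <= M)%R by near: M; apply: nbhs_pinfty_ge; rewrite num_real.
wlog xy : x y x0 y0 / (x <= y)%R.
  move=> h; have /orP[xy|yx] := le_total x y; first exact: h.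
  by rewrite distrC (distrC x) h.
rewrite distrC (distrC x) (ger0_norm (_ : 0 <= y - x)%R) ?subr_ge0//.
have /andP[/ger0_norm -> incr_xy] := incr _ _ x0 xy.
by rewrite (le_trans incr_xy)// ler_wpM2r ?subr_ge0.
Unshelve. all: by end_near. Qed.
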